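(* Let $\mathcal L$ be a language in the logic of metric structures with a distinguished constant symbol $0_{\mathcal S}$ for every sort $\mathcal S$, let $A_n$, $n\in\omega$, be $\mathcal L$-structures, and let $\mathcal I$ be a layered ideal on $\omega$. Then the reduced product $\prod_n A_n/\bigoplus_{\mathcal I}A_n$ is countably saturated.
   Context: An ideal $\mathcal I$ on $\omega$ is layered if there is $f\colon\mathcal P(\omega)\to[0,\infty]$ such that (1) $A\subseteq B$ implies $f(A)\le f(B)$; (2) $\mathcal I=\{A:f(A)<\infty\}$; (3) $f(A)=\infty$ implies $f(A)=\sup\{f(B):B\subseteq A,\ f(B)<\infty\}$. Logic of metric structures: structures have sorts, each with bounded complete domains; function and predicate symbols have fixed moduli of uniform continuity on domains; formulas are built from atomic formulas by continuous real-valued connectives and the quantifiers $\sup$, $\inf$ over domains; every variable ranges over a fixed domain. $\prod_n A_n$ is the set of sequences $\bar x=(x_n)$ with $x_n\in A_n$ and all $x_n$ in the same domain; $\bigoplus_{\mathcal I}A_n$ is the union over sorts $\mathcal S$ of the sets of $\bar x\in\prod_n A_n$ of sort $\mathcal S$ such that for every $\epsilon>0$ there is $Z\in\mathcal I$ with $\sup_{n\notin Z}d(x_n,0_{\mathcal S})\le\epsilon$. On the quotient, with quotient map $q$, $d(q(\bar a),q(\bar b))=\limsup_{\mathcal I}d(a_n,b_n)$, $R(q(\bar a))=\limsup_{\mathcal I}R(a_n)$ for predicate symbols $R$, and $f(q(\bar a))=q((f(a_n))_n)$ for function symbols $f$, where $\limsup_{\mathcal I}r_n=\inf_{Z\in\mathcal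 I}\sup_{n\notin Z}r_n$; $q(\bar a)=q(\bar b)$ iff $d(q(\bar a),q(\bar b))=0$. A condition over a structure $B$ is an expression $\phi(\bar x)=r$ with $\phi$ a formula, possibly with parameters from $B$, and $r\in\mathbb R$. A type over $B$ is a set of conditions over $B$ with free variables among a fixed finite tuple $\bar x$. It is realized if some tuple $\bar a$ in $B$ of the appropriate sort satisfies $\phi(\bar a)^B=r$ for all its conditions; it is consistent if for every finite subset and every $\epsilon>0$ there is $\bar a$ in $B$ with $|\phi(\bar a)^B-r|\le\epsilon$ for all conditions in the finite subset. $B$ is countably saturated if every consistent type over $B$ with countably many conditions is realized in $B$. *)

(* Defs.v *)
From HB Require Import structures.
From mathcomp Require Import all_boot all_order all_algebra generic_quotient.
From mathcomp Require Import lra.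
From mathcomp Require Import all_classical all_reals all_analysis.

Set Implicit Arguments.
Unset Strict Implicit.
Unset Printing Implicit Defensive.

Import Order.TTheory GRing.Theory Num.Theory.
Import numFieldNormedType.Exports.

Local Open Scope classical_set_scope.
Local Open Scope ring_scope.
Local Open Scope quotient_scope.

Record ideal := Ideal {
  ideal_set :> set nat -> Prop;
  ideal0 : ideal_set set0;
  ideal_sub : forall X Y, X `<=` Y -> ideal_set Y -> ideal_set X;
  idealU : forall X Y, ideal_set X -> ideal_set Y -> ideal_set (X `|` Y);
  ideal_proper : ~ ideal_set setT }.

Definition layered (R : realType) (I : ideal) : Prop :=
  exists f : set nat -> \bar R,
  [/\ forall X, (0 <= f X)%E,
      forall X Y, X `<=` Y -> (f X <= f Y)%E,
      forall X, I X <-> (f X < +oo)%E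
    & forall X, f X = +oo%E ->
        f X = ereal_sup [set f Y | Y in [set Y | Y `<=` X /\ (f Y < +oo)%E]]].

(* The suprema and the infimum are real-valued: this is used for bounded
   sequences [r] only, and [~` Z] is never empty since [I] is proper. *)
Definition limsup_ideal (R : realType) (I : ideal) (r : nat -> R) : R :=
  inf [set sup [set r n | n in ~` Z] | Z in I].

Definition ideal_dual (I : ideal) : set_system nat := [set X | I (~` X)].

#[export] Instance ideal_dual_filter (I : ideal) : ProperFilter (ideal_dual I).
Proof.
split; first by rewrite /ideal_dual /mkset setC0; exact: ideal_proper.
split; rewrite /ideal_dual /mkset.
- by rewrite setCT; exact: ideal0.
- by move=> P Q IP IQ; rewrite setCI; exact: idealU.
- by move=> P Q PQ; apply: ideal_sub; exact: subsetC.
Qed.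

Section limsup_ideal.
Context {R : realType} (I : ideal).
Implicit Types (r s : nat -> R) (b c e : R).

Let nout Z : I Z -> exists n, ~ Z n.
Proof.
move=> IZ; apply: contrapT => h; apply: (@ideal_proper I).
by apply: ideal_sub IZ => n _; apply: contrapT => Zn; apply: h; exists n.
Qed.

Let supP r b Z : (forall n, `|r n| <= b) -> forall n, ~ Z n ->
  r n <= sup [set r n | n in ~` Z].
Proof.
move=> rb n Zn; apply: ub_le_sup; last by exists n.
by exists b => _ [m _ <-]; exact: le_trans (ler_norm _) (rb m).
Qed.

Let lbP r b : (forall n, `|r n| <= b) ->
  has_lbound [set sup [set r n | n in ~` Z] | Z in I].
Proof.
move=> rb; exists (- b) => _ [Z IZ <-]; have [n Zn] := nout IZ.
apply: le_trans (supP rb Zn).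
by have := rb n; rewrite ler_norml => /andP[].
Qed.

Lemma limsup_ideal_le r b c : (forall n, `|r n| <= b) ->
  (\forall n \near ideal_dual I, r n <= c) -> limsup_ideal I r <= c.
Proof.
move=> rb rc; set Z := ~` [set n | r n <= c].
have IZ : I Z by exact: rc.
apply: (@le_trans _ _ (sup [set r n | n in ~` Z])).
  by apply: ge_inf (lbP rb) _ _; exists Z.
apply: ge_sup; first by have [n Zn] := nout IZ; exists (r n), n.
by move=> _ [n Zn <-]; apply: contrapT => rn; apply: Zn.
Qed.

Lemma limsup_ideal_ge r b c : (forall n, `|r n| <= b) ->
  (\forall n \near ideal_dual I, c <= r n) -> c <= limsup_ideal I r.
Proof.
move=> rb rc; apply: lb_le_inf.
  by exists (sup [set r n | n in ~` set0]), set0 => //; exact: ideal0.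
move=> _ [Z IZ <-].
have [|n [cn Zn]] := @filter_ex _ (ideal_dual I) _ ([set n | c <= r n] `&` ~` Z).
  by apply: filterI => //; rewrite /ideal_dual /mkset setCK.
exact: le_trans cn (supP rb Zn).
Qed.

Lemma limsup_ideal_lt r b c : (forall n, `|r n| <= b) ->
  limsup_ideal I r < c -> \forall n \near ideal_dual I, r n < c.
Proof.
move=> rb /inf_lt[|_ [Z IZ <-] rc].
  by exists (sup [set r n | n in ~` set0]), set0 => //; exact: ideal0.
apply: (@filterS _ (ideal_dual I) _ (~` Z)); last first.
  by rewrite /ideal_dual /mkset setCK.
by move=> n Zn; exact: le_lt_trans (supP rb Zn) rc.
Qed.

Lemma limsup_ideal_close r s b c e :
  (forall n, `|r n| <= b) -> (forall n, `|s n| <= c) ->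
  (\forall n \near ideal_dual I, `|r n - s n| <= e) ->
  `|limsup_ideal I r - limsup_ideal I s| <= e.
Proof.
have H r1 s1 b1 c1 : (forall n, `|r1 n| <= b1) -> (forall n, `|s1 n| <= c1) ->
  (\forall n \near ideal_dual I, `|r1 n - s1 n| <= e) ->
  limsup_ideal I r1 - limsup_ideal I s1 <= e.
  move=> rb sc rs; apply/ler_addgt0Pl => d d0.
  rewrite lerBlDr; apply: (limsup_ideal_le rb).
  have := @limsup_ideal_lt s1 c1 (d + limsup_ideal I s1) sc.
  rewrite ltrDr => /(_ d0) sd.
  apply: filterS2 rs sd => n; rewrite ler_norml => /andP[_] h1 h2; lra.
move=> rb sc rs; rewrite ler_norml; apply/andP; split; last exact: H rb sc rs.
rewrite lerNl opprB; apply: H sc rb _.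
by apply: filterS rs => n; rewrite distrC.
Qed.

End limsup_ideal.

(* Every language has, besides the symbols listed here, a metric symbol and a
   distinguished constant symbol for each sort; other constants are function
   symbols of arity 0.
   Moduli of uniform continuity compare a tuple in the domains [D] with one in
   the domains [E], the case [D = E] being uniform continuity on [D]. Two
   representatives of a point of a reduced product may lie in different
   domains, so this is what makes the symbols well defined on the quotient; if
   any two domains lie in a common one, it follows from the case [D = E].
   The bounds on the metric and on the predicates make limsups finite. *)
Record language (R : realType) := Language {
  sort_sym : Type;
  dom_sym : sort_sym -> Type;
  fun_sym : Type;
  farity : fun_sym -> nat;
  fsrc : forall f, 'I_(farity f) -> sort_sym;
  ftgt : fun_sym -> sort_sym;
  pred_sym : Type;
  parity : pred_sym -> nat;
  psrc : forall p, 'I_(parity p) -> sort_sym;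
  zdom : forall s, dom_sym s;
  dbound : forall s, dom_sym s -> dom_sym s -> R;
  fdom : forall f, (forall i, dom_sym (@fsrc f i)) -> dom_sym (ftgt f);
  fmod : forall f, (forall i, dom_sym (@fsrc f i)) ->
    (forall i, dom_sym (@fsrc f i)) -> R -> R;
  fmod_gt0 : forall f D E e, 0 < e -> 0 < @fmod f D E e;
  pbound : forall p, (forall i, dom_sym (@psrc p i)) -> R;
  pmod : forall p, (forall i, dom_sym (@psrc p i)) ->
    (forall i, dom_sym (@psrc p i)) -> R -> R;
  pmod_gt0 : forall p D E e, 0 < e -> 0 < @pmod p D E e }.

Arguments dom_sym {R} l s.
Arguments fun_sym {R} l.
Arguments pred_sym {R} l.
Arguments farity {R l} f.
Arguments fsrc {R l f} i.
Arguments ftgt {R l} f.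
Arguments parity {R l} p.
Arguments psrc {R l p} i.
Arguments zdom {R l} s.
Arguments dbound {R l s} D E.
Arguments fdom {R l f} D.
Arguments fmod {R l f} D E e.
Arguments pbound {R l p} D.
Arguments pmod {R l p} D E e.

Definition complete_subset (R : realType) (T : metricType R) (D : set T) :=
  forall u : nat -> T, (forall k, D (u k)) -> cauchy (u @ \oo) ->
  exists2 x, D x & u @ \oo --> x.

Record structure (R : realType) (L : language R) := Structure {
  carrier :> sort_sym L -> metricType R;
  dset : forall s, dom_sym L s -> set (carrier s);
  zint : forall s, carrier s;
  fint : forall f : fun_sym L,
    (forall i, carrier (@fsrc R L f i)) -> carrier (ftgt f);
  pint : forall p : pred_sym L, (forall i, carrier (@psrc R L p i)) -> R;
  dset_cover : forall s (x : carrier s), exists D, dset D x;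
  dset_nonempty : forall s (D : dom_sym L s), dset D !=set0;
  dset_complete : forall s (D : dom_sym L s), complete_subset (dset D);
  dset_bounded : forall s (D E : dom_sym L s) x y, dset D x -> dset E y ->
    mdist x y <= dbound D E;
  zint_dom : forall s, dset (zdom s) (zint s);
  fint_dom : forall f D a, (forall i, dset (D i) (a i)) ->
    dset (fdom D) (@fint f a);
  fint_mod : forall f D E a b, (forall i, dset (D i) (a i)) ->
    (forall i, dset (E i) (b i)) -> forall e, 0 < e ->
    (forall i, mdist (a i) (b i) < fmod D E e) ->
    mdist (@fint f a) (@fint f b) <= e;
  pint_bound : forall p D a, (forall i, dset (D i) (a i)) ->
    `|@pint p a| <= pbound D;
  pint_mod : forall p D E a b, (forall i, dset (D i) (a i)) ->
    (forall i, dset (E i) (b i)) -> forall e, 0 < e ->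
    (forall i, mdist (a i) (b i) < pmod D E e) ->
    `|@pint p a - @pint p b| <= e }.

Arguments dset {R L} s0 {s} D : rename.
Arguments zint {R L} s0 s : rename.
Arguments fint {R L} s f a : rename.
Arguments pint {R L} s p a : rename.

Definition domain (R : realType) (L : language R) :=
  {s : sort_sym L & dom_sym L s}.

(* Variables are the elements of a type [X], and [V x] is the domain over which
   [x] ranges; a quantifier binds the variable [None] of [option X]. [P s] is
   the type of the names of parameters of sort [s]. *)
Section syntax.
Context {R : realType} (L : language R) (P : sort_sym L -> Type).

Definition extend X (V : X -> domain L) (D : domain L) : option X -> domain L :=
  fun o => if o is Some x then V x else D.

Inductive term X (V : X -> domain L) : sort_sym L -> Type :=
| TVar (x : X) : term V (tag (V x))
| TPar s (p : P s) : term V s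
| TZero s : term V s
| TApp (f : fun_sym L) (t : forall i, term V (@fsrc R L f i)) : term V (ftgt f).

Inductive formula X (V : X -> domain L) : Type :=
| FDist s (t u : term V s) : formula V
| FPred (p : pred_sym L) (t : forall i, term V (@psrc R L p i)) : formula V
| FConn k (u : 'rV[R]_k -> R) (uC : continuous u) (phi : 'I_k -> formula V) :
    formula V
| FSup (D : domain L) (phi : formula (extend V D)) : formula V
| FInf (D : domain L) (phi : formula (extend V D)) : formula V.

End syntax.

Section semantics.
Context {R : realType} {L : language R}.
Context (P : sort_sym L -> Type) (B : structure L).
Variable rho : forall s, P s -> B s.

Definition extend_val X (V : X -> domain L) (v : forall x, B (tag (V x)))
    (D : domain L) (a : B (tag D)) : forall o, B (tag (extend V D o)) :=
  fun o => match o with Some x => v x | None => a end.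

Fixpoint teval X (V : X -> domain L) (v : forall x, B (tag (V x))) s
    (t : term P V s) : B s :=
  match t with
  | TVar x => v x
  | TPar s p => rho p
  | TZero s => zint B s
  | TApp f t => fint B f (fun i => teval v (t i))
  end.

(* Formulas are bounded on tuples in the domains of their variables, hence
   the real-valued suprema and infima below are the intended ones. *)
Fixpoint feval X (V : X -> domain L) (phi : formula P V) :
    (forall x, B (tag (V x))) -> R :=
  match phi with
  | FDist s t u => fun v => mdist (teval v t) (teval v u)
  | FPred p t => fun v => pint B p (fun i => teval v (t i))
  | FConn k u _ phi => fun v => u (\row_i feval (phi i) v)
  | FSup D phi => fun v =>
      sup [set feval phi (extend_val v a) | a in dset B (tagged D)]
  | FInf D phi => fun v =>
      inf [set feval phi (extend_val v a) | a in dset B (tagged D)]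
  end.

End semantics.

Section saturation.
Context {R : realType} {L : language R} (B : structure L).

(* Parameters are named by the elements of [B] themselves, and
   [(phi, r)] stands for the condition [phi = r]. *)
Definition condition n (V : 'I_n -> domain L) : Type :=
  formula (fun s => B s) V * R.

Definition tuple_in n (V : 'I_n -> domain L) :=
  [set a : forall x, B (tag (V x)) | forall x, dset B (tagged (V x)) (a x)].

Definition value n (V : 'I_n -> domain L) (phi : formula (fun s => B s) V)
  (a : forall x, B (tag (V x))) : R := feval (fun s (b : B s) => b) phi a.

Definition realized n (V : 'I_n -> domain L) (t : set (condition V)) :=
  exists2 a, tuple_in a & forall c, t c -> value c.1 a = c.2.

Definition consistent n (V : 'I_n -> domain L) (t : set (condition V)) :=
  forall F, finite_set F -> F `<=` t -> forall e, 0 < e ->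
  exists2 a, tuple_in a & forall c, F c -> `|value c.1 a - c.2| <= e.

Definition countably_saturated :=
  forall n (V : 'I_n -> domain L) (t : set (condition V)),
  countable t -> consistent t -> realized t.

End saturation.

Lemma half_expn_lt (R : realType) (e : R) : 0 < e -> exists k, 2^-1 ^+ k < e.
Proof.
move=> e0; have /cvgrPdist_lt/(_ _ e0)[k _ /(_ k (leqnn k))] :
    (fun k => 2^-1 ^+ k : R) @ \oo --> 0.
  by apply: cvg_expr; rewrite ger0_norm ?invr_ge0// invf_lt1 ?ltr1n.
by rewrite /= sub0r normrN ger0_norm ?exprn_ge0 ?invr_ge0//; exists k.
Qed.

Lemma complete_geometric (R : realType) (T : metricType R) (D : set T)
    (y : nat -> T) : complete_subset D -> (forall k, D (y k)) ->
  (forall k, mdist (y k) (y k.+1) <= 2^-1 ^+ k) ->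
  exists2 z, D z & forall k, mdist (y k) z <= 2 * 2^-1 ^+ k.
Proof.
move=> DC yD yS; pose h k : R := 2^-1 ^+ k.
have h0 k : 0 < h k by rewrite exprn_gt0// invr_gt0.
have yk k m : mdist (y k) (y (k + m)%N) <= 2 * h k - 2 * h (k + m)%N.
  elim: m => [|m IHm]; first by rewrite addn0 mdistxx subrr.
  rewrite addnS; apply: le_trans (metric_triangle _ (y (k + m)%N) _) _.
  have := yS (k + m)%N; rewrite -/(h (k + m)%N).
  have -> : h (k + m).+1 = 2^-1 * h (k + m)%N by rewrite /h exprS.
  by move: IHm; set a := mdist _ _; set b := mdist _ _; lra.
have yle k i : (k <= i)%N -> mdist (y k) (y i) < 2 * h k.
  move=> /subnKC <-; apply: le_lt_trans (yk k (i - k)%N) _.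
  by rewrite gtrBl mulr_gt0.
have [|z Dz yz] := DC y yD.
  apply: cauchy_exP => e e0; have [k hk] := half_expn_lt (divr_gt0 e0 (ltr0n R 2)).
  exists (y k), k => // i /= ki; rewrite ballEmdist/=.
  by apply: lt_trans (yle _ _ ki) _; rewrite mulrC -ltr_pdivlMr.
exists z => // k; apply/ler_addgt0Pl => e e0.
have [m _ ym] := (metricType_numDomainType.cvgrPdist_lt y z).1 yz e e0.
have := ym (maxn k m) (leq_maxr _ _); have := yle k (maxn k m) (leq_maxl _ _).
have := metric_triangle (y k) (y (maxn k m)) z.
rewrite /= (metric_sym z) -/(h k); lra.
Qed.

Section product.
Context {R : realType} {L : language R} (A : nat -> structure L).

Definition product (s : sort_sym L) : Type :=
  {x : forall n, A n s | exists D, forall n, dset (A n) D (x n)}.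

HB.instance Definition _ s := gen_eqMixin (product s).
HB.instance Definition _ s := gen_choiceMixin (product s).

Definition pval s (x : product s) : forall n, A n s := sval x.

Definition pdset s (D : dom_sym L s) : set (product s) :=
  [set x | forall n, dset (A n) D (pval x n)].

Lemma pdset_cover s (x : product s) : exists D, pdset D x.
Proof. by case: x => x [D xD]; exists D. Qed.

Definition pdom s (x : product s) : dom_sym L s := sval (cid (pdset_cover x)).

Lemma pdomP s (x : product s) : pdset (pdom x) x.
Proof. exact: (svalP (cid (pdset_cover x))). Qed.

Definition pseq s (D : dom_sym L s) (x : forall n, A n s)
    (xD : forall n, dset (A n) D (x n)) : product s :=
  exist (fun x => exists D, forall n, dset (A n) D (x n)) x
    (ex_intro (fun D => forall n, dset (A n) D (x n)) D xD).

Definition pzero s : product s := pseq (fun n => zint_dom (A n) s).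

Lemma pfun_subproof (f : fun_sym L) (x : forall i, product (@fsrc R L f i)) :
  exists D, forall n, dset (A n) D (fint (A n) f (fun i => pval (x i) n)).
Proof.
exists (fdom (fun i => pdom (x i))) => n; apply: fint_dom => i.
exact: pdomP.
Qed.

Definition pfun (f : fun_sym L) (x : forall i, product (@fsrc R L f i)) :
  product (ftgt f) := exist _ _ (pfun_subproof x).

Variable I : ideal.

Definition direct_sum s : set (product s) :=
  [set x | forall e, 0 < e -> exists2 Z, I Z &
    sup [set mdist (pval x n) (zint (A n) s) | n in ~` Z] <= e].

Definition pdist s (x y : product s) : R :=
  limsup_ideal I (fun n => mdist (pval x n) (pval y n)).

Definition ppred (p : pred_sym L) (x : forall i, product (@psrc R L p i)) : R :=
  limsup_ideal I (fun n => pint (A n) p (fun i => pval (x i) n)).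

Lemma pdist_bounded s (x y : product s) n :
  `|mdist (pval x n) (pval y n)| <= dbound (pdom x) (pdom y).
Proof.
by rewrite ger0_norm ?mdist_ge0//; apply: dset_bounded; exact: pdomP.
Qed.

Lemma pdist_lt s (x y : product s) c : pdist x y < c ->
  \forall n \near ideal_dual I, mdist (pval x n) (pval y n) < c.
Proof. exact/limsup_ideal_lt/pdist_bounded. Qed.

Lemma pdist_le s (x y : product s) c :
  (\forall n \near ideal_dual I, mdist (pval x n) (pval y n) <= c) -> pdist x y <= c.
Proof. exact/limsup_ideal_le/pdist_bounded. Qed.

Lemma pdist_ge0 s (x y : product s) : 0 <= pdist x y.
Proof.
apply: (limsup_ideal_ge (pdist_bounded x y)).
by apply: nearW => n; exact: mdist_ge0.
Qed.

Lemma pdistxx s (x : product s) : pdist x x = 0.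
Proof.
apply/eqP; rewrite eq_le pdist_ge0 andbT; apply: pdist_le.
by apply: nearW => n; rewrite mdistxx.
Qed.

Lemma pdist_sym s (x y : product s) : pdist x y = pdist y x.
Proof.
by congr limsup_ideal; apply/funext => n; rewrite metric_sym.
Qed.

Lemma pdist_triangle s (y x z : product s) :
  pdist x z <= pdist x y + pdist y z.
Proof.
apply/ler_addgt0Pl => e e0; apply: pdist_le.
have xy : pdist x y < pdist x y + e / 2 by rewrite ltrDl divr_gt0.
have yz : pdist y z < pdist y z + e / 2 by rewrite ltrDl divr_gt0.
apply: filterS2 (pdist_lt xy) (pdist_lt yz) => n xyn yzn.
have := metric_triangle (pval x n) (pval y n) (pval z n); lra.
Qed.

Lemma pfun_mod f D E (x y : forall i, product (@fsrc R L f i)) :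
  (forall i, pdset (D i) (x i)) -> (forall i, pdset (E i) (y i)) ->
  forall e, 0 < e -> (forall i, pdist (x i) (y i) < fmod D E e) ->
  pdist (pfun x) (pfun y) <= e.
Proof.
move=> xD yE e e0 xy; apply: pdist_le.
have : \forall n \near ideal_dual I,
    forall i, mdist (pval (x i) n) (pval (y i) n) < fmod D E e.
  by apply: filter_forall => i; exact: pdist_lt.
apply: filterS => n xyn; apply: (@fint_mod _ _ _ _ D E) => // i;
  [exact: xD|exact: yE].
Qed.

Lemma ppred_bounded p D (x : forall i, product (@psrc R L p i)) :
  (forall i, pdset (D i) (x i)) ->
  forall n, `|pint (A n) p (fun i => pval (x i) n)| <= pbound D.
Proof. by move=> xD n; apply: pint_bound => i; exact: xD. Qed.

Lemma ppred_mod p D E (x y : forall i, product (@psrc R L p i)) :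
  (forall i, pdset (D i) (x i)) -> (forall i, pdset (E i) (y i)) ->
  forall e, 0 < e -> (forall i, pdist (x i) (y i) < pmod D E e) ->
  `|ppred x - ppred y| <= e.
Proof.
move=> xD yE e e0 xy.
apply: (limsup_ideal_close (ppred_bounded xD) (ppred_bounded yE)).
have : \forall n \near ideal_dual I,
    forall i, mdist (pval (x i) n) (pval (y i) n) < pmod D E e.
  by apply: filter_forall => i; exact: pdist_lt.
apply: filterS => n xyn; apply: (@pint_mod _ _ _ _ D E) => // i;
  [exact: xD|exact: yE].
Qed.

Definition peq s (x y : product s) : bool := pdist x y == 0.

Lemma peq_refl s : reflexive (@peq s).
Proof. by move=> x; rewrite /peq pdistxx. Qed.

Lemma peq_sym s : symmetric (@peq s).
Proof. by move=> x y; rewrite /peq pdist_sym. Qed.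

Lemma peq_trans s : transitive (@peq s).
Proof.
move=> y x z /eqP xy /eqP yz; rewrite /peq eq_le pdist_ge0 andbT.
by apply: le_trans (pdist_triangle y x z) _; rewrite xy yz addr0.
Qed.

Definition peq_equiv s : equiv_rel (product s) :=
  EquivRel (@peq s) (@peq_refl s) (@peq_sym s) (@peq_trans s).

Definition rprod (s : sort_sym L) : Type := {eq_quot (peq_equiv s)}.

HB.instance Definition _ s := Choice.on (rprod s).

Definition quo s (x : product s) : rprod s := \pi_{eq_quot (peq_equiv s)} x.

Lemma quoP s (x y : product s) : quo x = quo y <-> pdist x y = 0.
Proof.
split=> [/eqmodP/eqP//|xy]; apply/eqmodP.
by rewrite /= /peq xy.
Qed.

Definition rep s (a : rprod s) : product s := repr a.

Lemma repK s (a : rprod s) : quo (rep a) = a.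
Proof. exact: reprK. Qed.

Lemma pdist_rep s (x : product s) : pdist (rep (quo x)) x = 0.
Proof. by apply/quoP; rewrite repK. Qed.

Definition qdist s (a b : rprod s) : R := pdist (rep a) (rep b).

Lemma qdist_quo s (x y : product s) : qdist (quo x) (quo y) = pdist x y.
Proof.
have H (x1 y1 x2 y2 : product s) : pdist x1 x2 = 0 -> pdist y1 y2 = 0 ->
    pdist x1 y1 <= pdist x2 y2.
  move=> xx yy; apply: le_trans (pdist_triangle x2 _ _) _.
  rewrite xx add0r; apply: le_trans (pdist_triangle y2 _ _) _.
  by rewrite (pdist_sym y2) yy addr0.
apply/eqP; rewrite eq_le /qdist.
by rewrite !H//; first [exact: pdist_rep|rewrite pdist_sym; exact: pdist_rep].
Qed.

Lemma qdistxx s (a : rprod s) : qdist a a = 0.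
Proof. exact: pdistxx. Qed.

Lemma qdist_positivity s (a b : rprod s) : qdist a b = 0 -> a = b.
Proof. by move=> /quoP; rewrite !repK. Qed.

Lemma qdist_sym s (a b : rprod s) : qdist a b = qdist b a.
Proof. exact: pdist_sym. Qed.

Lemma qdist_triangle s (b a c : rprod s) :
  qdist a c <= qdist a b + qdist b c.
Proof. exact: pdist_triangle. Qed.

HB.instance Definition _ s := isMetric.Build R (rprod s)
  (@qdistxx s) (@qdist_positivity s) (@qdist_sym s) (@qdist_triangle s).

Lemma mdist_quo s (x y : product s) : mdist (quo x) (quo y) = pdist x y.
Proof. exact: qdist_quo. Qed.

Definition qdset s (D : dom_sym L s) : set (rprod s) := @quo s @` pdset D.

Definition qfun (f : fun_sym L) (a : forall i, rprod (@fsrc R L f i)) :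
  rprod (ftgt f) := quo (pfun (fun i => rep (a i))).

Definition qpred (p : pred_sym L) (a : forall i, rprod (@psrc R L p i)) : R :=
  ppred (fun i => rep (a i)).

Lemma qfun_quo f (x : forall i, product (@fsrc R L f i)) :
  qfun (fun i => quo (x i)) = quo (pfun x).
Proof.
apply/quoP/eqP; rewrite eq_le pdist_ge0 andbT; apply/ler_addgt0Pl => e e0.
rewrite addr0.
apply: (pfun_mod (fun i => pdomP _) (fun i => pdomP _) e0) => i.
by rewrite pdist_rep fmod_gt0.
Qed.

Lemma qpred_quo p (x : forall i, product (@psrc R L p i)) :
  qpred (fun i => quo (x i)) = ppred x.
Proof.
apply/eqP; rewrite -subr_eq0 -normr_le0; apply/ler_addgt0Pl => e e0.
rewrite addr0.
apply: (ppred_mod (fun i => pdomP _) (fun i => pdomP _) e0) => i.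
by rewrite pdist_rep pmod_gt0.
Qed.

Lemma direct_sumP s (x : product s) : direct_sum x <-> quo x = quo (pzero s).
Proof.
split=> [xS|/quoP x0 e e0].
  apply/quoP/eqP; rewrite eq_le pdist_ge0 andbT; apply/ler_addgt0Pl => e e0.
  rewrite addr0; have [Z IZ xZ] := xS _ e0; apply: pdist_le.
  apply: (@filterS _ (ideal_dual I) _ (~` Z)); last first.
    by rewrite /ideal_dual /mkset setCK.
  move=> n Zn; apply: le_trans xZ; apply: ub_le_sup; last by exists n.
  exists (dbound (pdom x) (pdom (pzero s))) => _ [m _ <-].
  exact: le_trans (ler_norm _) (pdist_bounded x (pzero s) m).
have := @pdist_lt s x (pzero s) e; rewrite x0 => /(_ e0) xe.
exists (~` [set n | mdist (pval x n) (pval (pzero s) n) < e]); first exact: xe.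
rewrite setCK; apply: ge_sup.
  by have [n xn] := filter_ex xe; eexists; exists n; [exact: xn|].
by move=> _ [n xn <-]; exact: ltW.
Qed.

Lemma qdset_args k (src : 'I_k -> sort_sym L) (D : forall i, dom_sym L (src i))
    (a : forall i, rprod (src i)) : (forall i, qdset (D i) (a i)) ->
  exists2 x : forall i, product (src i), forall i, pdset (D i) (x i) &
    a = fun i => quo (x i).
Proof.
move=> aD; pose c i := cid2 (aD i).
exists (fun i => s2val (c i)) => [i|]; first exact: s2valP.
by apply: functional_extensionality_dep => i; rewrite (s2valP' (c i)).
Qed.

Lemma qdset_cover s (a : rprod s) : exists D, qdset D a.
Proof.
by exists (pdom (rep a)), (rep a); [exact: pdomP|exact: repK].
Qed.

Lemma qdset_nonempty s (D : dom_sym L s) : qdset D !=set0.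
Proof.
pose c n := cid (dset_nonempty (A n) D).
have cD n : dset (A n) D (sval (c n)) by exact: svalP.
by exists (quo (pseq cD)), (pseq cD).
Qed.

Lemma qdset_bounded s (D E : dom_sym L s) (a b : rprod s) :
  qdset D a -> qdset E b -> mdist a b <= dbound D E.
Proof.
move=> [x xD <-] [y yE <-]; rewrite mdist_quo; apply: pdist_le.
by apply: nearW => n; exact: dset_bounded.
Qed.

Lemma qzero_dom s : qdset (zdom s) (quo (pzero s)).
Proof. by exists (pzero s) => // n; exact: zint_dom. Qed.

Lemma qfun_dom f D (a : forall i, rprod (@fsrc R L f i)) :
  (forall i, qdset (D i) (a i)) -> qdset (fdom D) (qfun a).
Proof.
move=> /qdset_args[x xD ->]; rewrite qfun_quo; exists (pfun x) => // n.
by apply: fint_dom => i; exact: xD.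
Qed.

Lemma qfun_mod f D E (a b : forall i, rprod (@fsrc R L f i)) :
  (forall i, qdset (D i) (a i)) -> (forall i, qdset (E i) (b i)) ->
  forall e, 0 < e -> (forall i, mdist (a i) (b i) < fmod D E e) ->
  mdist (qfun a) (qfun b) <= e.
Proof.
move=> /qdset_args[x xD ->] /qdset_args[y yE ->] e e0 ab.
rewrite !qfun_quo mdist_quo; apply: (pfun_mod xD yE e0) => i.
by rewrite -mdist_quo.
Qed.

Lemma qpred_bound p D (a : forall i, rprod (@psrc R L p i)) :
  (forall i, qdset (D i) (a i)) -> `|qpred a| <= pbound D.
Proof.
move=> /qdset_args[x xD ->]; rewrite qpred_quo ler_norml.
have xb := ppred_bounded xD; apply/andP; split.
  apply: (limsup_ideal_ge xb); apply: nearW => n.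
  by have := xb n; rewrite ler_norml => /andP[].
apply: (limsup_ideal_le xb); apply: nearW => n.
exact: le_trans (ler_norm _) (xb n).
Qed.

Lemma qpred_mod p D E (a b : forall i, rprod (@psrc R L p i)) :
  (forall i, qdset (D i) (a i)) -> (forall i, qdset (E i) (b i)) ->
  forall e, 0 < e -> (forall i, mdist (a i) (b i) < pmod D E e) ->
  `|qpred a - qpred b| <= e.
Proof.
move=> /qdset_args[x xD ->] /qdset_args[y yE ->] e e0 ab.
rewrite !qpred_quo; apply: (ppred_mod xD yE e0) => i.
by rewrite -mdist_quo.
Qed.

Lemma qdset_complete s (D : dom_sym L s) : complete_subset (@qdset s D).
Proof.
move=> u uD uC; pose h k : R := 2^-1 ^+ k.
have h0 k : 0 < h k by rewrite exprn_gt0// invr_gt0.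
have fast k : exists N, forall i j, (N <= i)%N -> (N <= j)%N ->
    mdist (u i) (u j) < h k.
  have [[P Q]/= [[N1 _ PN] [N2 _ QN]] PQ] :=
    (cauchy_ballP (u @ \oo)).2 uC _ (h0 k).
  exists (maxn N1 N2) => i j; rewrite !geq_max => /andP[Ni _] /andP[_ Nj].
  have := PQ (u i, u j) (conj (PN _ Ni) (QN _ Nj)).
  by rewrite /= ballEmdist.
pose N k := sval (cid (fast k)).
have NP k : forall i j, (N k <= i)%N -> (N k <= j)%N ->
  mdist (u i) (u j) < h k := svalP (cid (fast k)).
pose M k := (\sum_(i < k.+1) N i)%N.
have NM k : (N k <= M k)%N by rewrite /M big_ord_recr leq_addl.
have MS k : (M k <= M k.+1)%N by rewrite /M [leqRHS]big_ord_recr leq_addr.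
pose c k := cid2 (uD (M k)).
pose x k : product s := s2val (c k).
have xD k : pdset D (x k) := s2valP (c k).
have xu k : quo (x k) = u (M k) := s2valP' (c k).
pose good n k := mdist (pval (x k) n) (pval (x k.+1) n) < h k.
have goodP k : \forall n \near ideal_dual I, good n k.
  apply: pdist_lt; rewrite -mdist_quo !xu; apply: NP => //.
  exact: leq_trans (NM k) (MS k).
pose y n := fix y k : A n s := if k is k'.+1 then
  if `[< forall j, (j <= k')%N -> good n j >] then pval (x k) n else y k'
  else pval (x 0%N) n.
have yD n k : dset (A n) D (y n k).
  elim: k => [|k IHk] /=; first exact: xD.
  by case: asboolP => // _; exact: xD.
have yx n k : (forall j, (j < k)%N -> good n j) -> y n k = pval (x k) n.
  by case: k => //= k gk; rewrite asboolT.
have ystep n k : mdist (y n k) (y n k.+1) <= h k.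
  have [gk|gk] := pselect (forall j, (j <= k)%N -> good n j).
    rewrite (yx n k) => [|j jk]; last by apply: gk; exact: ltnW.
    by rewrite (yx n k.+1)//; exact/ltW/gk.
  by rewrite /= asboolF// mdistxx ltW.
have lim n : exists2 z, dset (A n) D z & forall k, mdist (y n k) z <= 2 * h k.
  exact: (complete_geometric (@dset_complete _ _ (A n) s D) (yD n) (ystep n)).
pose l n := cid2 (lim n).
have lD n : dset (A n) D (s2val (l n)) by exact: s2valP.
pose z := pseq lD.
have xz k : mdist (quo (x k)) (quo z) <= 2 * h k.
  rewrite mdist_quo; apply: pdist_le.
  have : \forall n \near ideal_dual I, forall j : 'I_k, good n j.
    by apply: filter_forall => j; exact: goodP.
  apply: filterS => n gn; rewrite -yx => [|j jk]; last exact: (gn (Ordinal jk)).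
  exact: (s2valP' (l n)).
exists (quo z); first by exists z.
apply/metricType_numDomainType.cvgrPdist_lt => e e0.
have [k hk] : exists k, 3 * h k < e.
  have [k hk] := half_expn_lt (divr_gt0 e0 (ltr0n R 3)).
  by exists k; rewrite mulrC -ltr_pdivlMr.
exists (M k) => // i /= Mi; rewrite metric_sym.
apply: le_lt_trans (metric_triangle _ (u (M k)) _) _.
have := xz k; rewrite xu => uz.
have := NP k i (M k) (leq_trans (NM k) Mi) (NM k).
lra.
Qed.

Definition reduced_product : structure L :=
  @Structure R L (fun s => rprod s : metricType R) qdset
    (fun s => quo (pzero s)) qfun qpred
    qdset_cover qdset_nonempty qdset_complete qdset_bounded
    qzero_dom qfun_dom qfun_mod qpred_bound qpred_mod.

End product.

(* Main.v *)
(* Colour each [C n] with finitely many colours, and call pattern of a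
   sequence [a] the set of colours that [a] takes on an I-positive set. Every
   formula is, up to any [e > 0], a function of the pattern of its arguments for
   some finite colouring. For atomic formulas one discretizes the values. For a
   quantifier the new colour of [c] is the set of colours of the extensions
   [(c, b)]: when [a] and [a'] have the same pattern, every extension of [a] has
   the pattern of some extension of [a'], because an I-positive set contains
   many disjoint I-positive sets. Countably many conditions thus become
   countably many colourings; an ultrafilter selects the limit patterns of
   approximate realizations, and layeredness allows one to glue these into a
   single sequence having all the limit patterns. *)
Require Import Defs.
From mathcomp Require Import all_boot all_order all_algebra.
From mathcomp Require Import lra.
From mathcomp Require Import all_classical all_reals all_analysis.

Set Implicit Arguments.
Unset Strict Implicit.
Unset Printing Implicit Defensive.

Import Order.TTheory GRing.Theory Num.Theory.
Import numFieldNormedType.Exports.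

Local Open Scope classical_set_scope.
Local Open Scope ring_scope.

(** * Recurrent enumerations and [I]-positive sets *)

Definition unbounded (S : set nat) := forall N, exists2 m, (N <= m)%N & S m.

Lemma recurrent_enum (J : countType) :
  exists j : nat -> option J, forall x, unbounded [set m | j m = Some x].
Proof.
exists (fun m => unpickle (logn 2 m)) => x N.
(* The second factor is odd, so the 2-adic valuation is [pickle x], while the product exceeds
   [N]. *)
exists (2 ^ pickle x * (2 * N).+1)%N.
  apply: (@leq_trans (2 * N).+1); first by rewrite leqW// leq_pmull.
  by rewrite leq_pmull// expn_gt0.
by rewrite /= lognM ?expn_gt0// pfactorK// [logn 2 (_.+1)]lognE /=
  dvdn2 /= oddM /= addn0 pickleK.
Qed.

Section ideal.
Context (I : ideal).

Lemma ideal_dualC (X : set nat) : I X -> ideal_dual I (~` X).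
Proof. by rewrite /ideal_dual /mkset setCK. Qed.

Lemma positive_sub (X Y : set nat) : X `<=` Y -> ~ I X -> ~ I Y.
Proof. by move=> XY IX IY; exact: IX (ideal_sub XY IY). Qed.

Lemma positiveI (X Y : set nat) : ~ I X -> ideal_dual I Y -> ~ I (X `&` Y).
Proof.
move=> IX IY IXY; apply: IX; apply: ideal_sub (idealU IXY IY) => n Xn.
by have [Yn|Yn] := pselect (Y n); [left|right].
Qed.

Lemma positive_ex (X : set nat) : ~ I X -> exists n, X n.
Proof.
move=> IX; apply: contrapT => X0; apply: IX; apply: ideal_sub (ideal0 I) => n Xn.
by apply: X0; exists n.
Qed.

End ideal.

(** * Layered ideals *)

Section layered.
Context {R : realType} {I : ideal}.
Hypothesis I_layered : layered R I.

Let layer : {f : set nat -> \bar R | [/\ forall X, (0 <= f X)%E,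
      forall X Y, X `<=` Y -> (f X <= f Y)%E,
      forall X, I X <-> (f X < +oo)%E
    & forall X, f X = +oo%E ->
        f X = ereal_sup [set f Y | Y in [set Y | Y `<=` X /\ (f Y < +oo)%E]]]}.
Proof. exact: cid. Qed.

Let f := sval layer.
Let f_ge0 X : (0 <= f X)%E. Proof. by case: (svalP layer). Qed.
Let f_mono X Y : X `<=` Y -> (f X <= f Y)%E.
Proof. by case: (svalP layer) => _ + _ _; apply. Qed.
Let f_fin X : I X <-> (f X < +oo)%E.
Proof. by case: (svalP layer) => _ _ + _; apply. Qed.
Let f_sup X : f X = +oo%E ->
  f X = ereal_sup [set f Y | Y in [set Y | Y `<=` X /\ (f Y < +oo)%E]].
Proof. by case: (svalP layer) => _ _ _; apply. Qed.

Let f_oo X : ~ I X -> f X = +oo%E.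
Proof.
move=> IX; apply: contrapT => /eqP; rewrite -ltey => fX; apply: IX.
exact/f_fin.
Qed.

(** On a set of infinite value, layeredness makes the values of the subsets in [I] unbounded. *)
Let positive_layer X (m : nat) : ~ I X ->
  exists Y, [/\ Y `<=` X, I Y & (m%:R%:E < f Y)%E].
Proof.
move=> /f_oo fX.
have : (m%:R%:E < ereal_sup
    [set f Y | Y in [set Y | Y `<=` X /\ (f Y < +oo)%E]])%E.
  by rewrite -f_sup// fX ltey.
move=> /ereal_sup_gt[_ [Y [YX Yfin] <-] mY].
by exists Y; split=> //; exact/f_fin.
Qed.

(** A consequence of layeredness: were [[set n]] positive, it would have a subset in [I] of value
    above [f set0]; being nonempty, that subset would be [[set n]] itself. *)
Lemma ideal_set1 n : I [set n].
Proof.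
apply: contrapT => In.
have [Y [Yn IY fY]] := positive_layer (Num.truncn (fine (f set0))).+1 In.
have [Y0|/set0P[k Yk]] := eqVneq Y set0; last first.
  by case: In; apply: ideal_sub IY => l ->; rewrite -(Yn _ Yk).
move: fY; rewrite Y0; have : f set0 \is a fin_num.
  by rewrite ge0_fin_numE//; apply/f_fin; exact: ideal0.
move=> /fineK <-; rewrite lte_fin => /ltW; rewrite leNgt.
by rewrite truncnS_gt.
Qed.

Lemma ideal_dual_gt m : \forall n \near ideal_dual I, (m < n)%N.
Proof.
elim: m => [|m IHm]; first apply: filterS (ideal_dualC (ideal_set1 0%N)) => n.
  by move=> /eqP; rewrite lt0n.
apply: filterS2 IHm (ideal_dualC (ideal_set1 m.+1)) => n mn /eqP nm.
by rewrite ltn_neqAle mn eq_sym nm.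
Qed.

(* The level [h n] is the index of the last term containing [n] of a decreasing
   sequence with empty intersection of sets of the dual filter; the [m]-th
   difference of this sequence meets [E m] in a set of [f]-value above [m]. *)
Lemma layered_level (X E : nat -> set nat) : (forall m, ideal_dual I (X m)) ->
  exists h : nat -> nat,
  [/\ \forall n \near ideal_dual I, X (h n) n,
      forall m, \forall n \near ideal_dual I, (m <= h n)%N
    & forall S, unbounded S -> (forall m, S m -> ~ I (E m)) ->
        ~ I [set n | S (h n) /\ E (h n) n]].
Proof.
move=> XI.
have /choice[y yP] : forall Z, exists y : nat -> set nat, forall m,
    I (y m) /\ (~ I Z -> y m `<=` Z /\ (m%:R%:E < f (y m))%E).
  move=> Z; suff /choice[y yP] : forall m, exists Y, I Y /\
      (~ I Z -> Y `<=` Z /\ (m%:R%:E < f Y)%E) by exists y.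
  move=> m; have [IZ|IZ] := pselect (I Z).
    by exists set0; split=> //; exact: ideal0.
  by have [Y [YZ IY fY]] := positive_layer m IZ; exists Y.
(* Each stage discards the piece chosen inside [D m'] and [E m'], of value above [m'] if their
   intersection is positive; the clause [m' < n] makes the stages shrink to the empty set. *)
pose D := fix D m : set nat := if m is m'.+1 then
  [set n | [/\ D m' n, X m n, ~ y (D m' `&` E m') m' n & (m' < n)%N]] else X 0%N.
have DX m : D m `<=` X m by case: m => //= m n [].
have DI m : ideal_dual I (D m).
  elim: m => [|m IHm] /=; first exact: XI.
  have IY := ideal_dualC (yP (D m `&` E m) m).1.
  have IXm : ideal_dual I (X m.+1 `&` [set n | (m < n)%N]).
    by apply: filterI (XI _) _; exact: ideal_dual_gt.
  by apply: filterS3 IHm IXm IY => n Dm [].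
have Dd i j : (i <= j)%N -> D j `<=` D i.
  move=> /subnKC <-; elim: (j - i)%N => [|k IHk]; first by rewrite addn0.
  by rewrite addnS => n [/IHk].
have lastD n : exists m, D 0%N n -> D m n /\ ~ D m.+1 n.
  have [[m mP]|nm] := pselect (exists m, D m n /\ ~ D m.+1 n).
    by exists m.
  (* A point of every stage would satisfy [n < n] at stage [n.+1], so the default 0 concerns only
     points outside [D 0]. *)
  exists 0%N => D0; exfalso.
  have Dm m : D m n.
    by elim: m => // m Dm; apply: contrapT => Dm1; apply: nm; exists m.
  by case: (Dm n.+1) => _ _ _; rewrite ltnn.
have [h hP] := choice lastD.
have hge m n : D m n -> (m <= h n)%N.
  move=> Dm; rewrite leqNgt; apply/negP => hm.
  by case: (hP n (Dd _ _ (leq0n m) _ Dm)) => _; apply; exact: Dd Dm.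
exists h; split.
- by apply: filterS (DI 0%N) => n /hP[/DX].
- by move=> m; apply: filterS (DI m) => n; exact: hge.
- move=> S Sunb SE /f_fin fS.
  set T := [set n | _] in fS.
  have Tfin : f T \is a fin_num by rewrite ge0_fin_numE.
  (* For [m] in [S], the piece discarded after stage [m] has level [m], hence lies in [T]; for [m]
     above [f T] this contradicts monotonicity. *)
  have [m Nm Sm] := Sunb (Num.truncn (fine (f T))).+1.
  have [_ yE] := yP (D m `&` E m) m.
  have [|yDE my] := yE.
    by rewrite setIC; apply: positiveI => //; exact: SE.
  have yT : y (D m `&` E m) m `<=` T.
    move=> n yn; have [Dm Em] := yDE _ yn.
    suff -> : T n = (S m /\ E m n) by [].
    rewrite /T /=; suff -> : h n = m by [].
    apply/eqP; rewrite eqn_leq hge// andbT leqNgt; apply/negP => mh.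
    have [Dh _] := hP n (Dd _ _ (leq0n m) _ Dm).
    by case: (Dd _ _ mh _ Dh).
  have := lt_le_trans my (f_mono yT).
  rewrite -(fineK Tfin) lte_fin => /ltW; rewrite leNgt => /negP; apply.
  by apply: lt_le_trans (truncnS_gt _) _; rewrite ler_nat.
Qed.

End layered.

(** * Patterns of coloured sequences *)

Definition pattern (I : ideal) (C : nat -> Type) (K : finType)
    (col : forall n, C n -> K) (a : forall n, C n) : {set K} :=
  [set k | `[< ~ I [set n | col n (a n) = k] >]].

Section pattern.
Context {I : ideal} {C : nat -> Type} {K : finType}.
Implicit Types (col : forall n, C n -> K) (a : forall n, C n) (T : {set K}).

Lemma patternP col a k :
  reflect (~ I [set n | col n (a n) = k]) (k \in pattern I col a).
Proof. by rewrite inE; exact: asboolP. Qed.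

(** Finitely many colours lie outside the pattern, and each of them is taken only on a set of
    [I]. *)
Lemma near_pattern col a :
  \forall n \near ideal_dual I, col n (a n) \in pattern I col a.
Proof.
have H : \forall n \near ideal_dual I,
    forall k : K, k \notin pattern I col a -> col n (a n) != k.
  apply: filter_forall => k; have [kp|kp] := boolP (k \in pattern I col a).
    exact: nearW.
  have /ideal_dualC : I [set n | col n (a n) = k].
    by apply: contrapT => /patternP; exact/negP.
  by apply: filterS => n /eqP.
apply: filterS H => n H; apply: contraT => /H.
by rewrite eqxx.
Qed.

Lemma pattern_eq col a T :
  (\forall n \near ideal_dual I, col n (a n) \in T) ->
  (forall k, k \in T -> ~ I [set n | col n (a n) = k]) ->
  pattern I col a = T.
Proof.
move=> aT Ta; apply/setP => k; apply/patternP/idP => [Ik|/Ta//].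
by have [n [<-]] := positive_ex (positiveI Ik aT).
Qed.

End pattern.

(** This lets a colouring be replaced by any finer one: equality of patterns survives the merging of
    colours. *)
Lemma pattern_comp (I : ideal) (C : nat -> Type) (K K' : finType)
    (col : forall n, C n -> K) (p : K -> K') (a : forall n, C n) :
  pattern I (fun n c => p (col n c)) a = p @: pattern I col a.
Proof.
apply: pattern_eq.
  by apply: filterS (near_pattern col a) => n; exact: imset_f.
by move=> _ /imsetP[k /patternP kI ->]; apply: positive_sub kI => n /= ->.
Qed.

(** * Lifting of extensions and limits of patterns *)

Section saturation.
Context {R : realType} {I : ideal}.
Hypothesis I_layered : layered R I.

(** The set [T] of wanted colours meets every colour set in the common pattern, so [b'] can stay
    inside [T]; every colour of [T] belongs to some such set, so it is available on a positive set,
    and the levels share out the coordinates among the colours. *)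
Lemma pattern_lift (C B C' : nat -> Type) (ext : forall n, C n -> B n -> C' n)
    (K : finType) (col : forall n, C' n -> K) (a a' : forall n, C n)
    (b : forall n, B n) :
  let ecol n c := [set k | `[< exists y, col n (ext n c y) = k >]]%SET in
  pattern I ecol a = pattern I ecol a' ->
  exists b' : forall n, B n,
    pattern I col (fun n => ext n (a' n) (b' n)) =
    pattern I col (fun n => ext n (a n) (b n)).
Proof.
move=> ecol aa'; set T := pattern I col (fun n => ext n (a n) (b n)).
have ecolP n c k : reflect (exists y, col n (ext n c y) = k) (k \in ecol n c).
  by rewrite inE; exact: asboolP.
have bT : \forall n \near ideal_dual I, col n (ext n (a n) (b n)) \in T.
  exact: near_pattern.
have T_meets s : s \in pattern I ecol a' -> exists2 k, k \in T & k \in s.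
  rewrite -aa' => /patternP sI.
  have [n [<- nT]] := positive_ex (positiveI sI bT).
  by exists (col n (ext n (a n) (b n))) => //; apply/ecolP; exists (b n).
have T_covered k : k \in T -> exists2 s, s \in pattern I ecol a' & k \in s.
  move=> /patternP kI.
  have [n [<- np]] := positive_ex (positiveI kI (near_pattern ecol a)).
  exists (ecol n (a n)); first by rewrite -aa'.
  by apply/ecolP; exists (b n).
have [j j_rec] := recurrent_enum K.
(* At level [m] the wanted colour is [j m], and [E m] collects the coordinates where an extension of
   [a' n] attains it. Each colour is wanted at unboundedly many levels, as [layered_level]
   demands. *)
pose E m := [set n | exists k, [/\ j m = Some k, k \in T & k \in ecol n (a' n)]].
have [h [_ _ hE]] := @layered_level _ _ I_layered (fun=> setT) E
  (fun=> @filterT _ (ideal_dual I) _).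
have b'P n : exists y, (ecol n (a' n) \in pattern I ecol a' ->
    col n (ext n (a' n) y) \in T) /\
    (E (h n) n -> j (h n) = Some (col n (ext n (a' n) y))).
  (* The colour wanted at the level of [n] has priority; failing that, any colour of [T] will do.
     The default [b n] is used only on a set of [I]. *)
  have [[k [jk kT /ecolP[y yk]]]|nE] := pselect (E (h n) n).
    by exists y; rewrite yk.
  have [/T_meets[k kT /ecolP[y yk]]|np] :=
    boolP (ecol n (a' n) \in pattern I ecol a').
  - by exists y; rewrite yk.
  - by exists (b n).
pose b' n := sval (cid (b'P n)).
have b'T n := (svalP (cid (b'P n))).1 : _ -> col n (ext n (a' n) (b' n)) \in T.
have b'E n := (svalP (cid (b'P n))).2 : _ -> _ = Some (col n (ext n _ (b' n))).
exists b'; apply: pattern_eq.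
  by apply: filterS (near_pattern ecol a') => n; exact: b'T.
move=> k kT; apply: positive_sub (hE [set m | j m = Some k] (j_rec k) _).
- move=> n [/= jk En].
  by have := b'E n En; rewrite jk => -[].
- move=> m jm; have [s /patternP sI ks] := T_covered k kT.
  by apply: positive_sub sI => n /= sE; exists k; split=> //; rewrite sE.
Qed.

(** A diagonal argument: coordinate [n] is taken from [c (h n)]. Levels tend to infinity along the
    dual filter, so the sets [X] keep the colours of each [col i] inside [T i]; a recurrent
    enumeration of all pairs of an index and a colour makes every colour of [T i] occur
    positively. *)
Lemma pattern_limit (C : nat -> Type) (K : nat -> finType)
    (col : forall i n, C n -> K i) (T : forall i, {set K i})
    (c : nat -> forall n, C n) :
  (forall m i, (i < m)%N -> pattern I (col i) (c m) = T i) ->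
  exists b, forall i, pattern I (col i) b = T i.
Proof.
move=> cT; have [j j_rec] := recurrent_enum {i : nat & K i}.
pose X m := [set n | forall i : 'I_m, col i n (c m n) \in T i].
pose E m := [set n | exists2 x, j m = Some x & col (tag x) n (c m n) = tagged x].
have XI m : ideal_dual I (X m).
  suff : \forall n \near ideal_dual I, forall i : 'I_m, col i n (c m n) \in T i.
    by [].
  apply: filter_forall => i; rewrite -(cT m i (ltn_ord i)).
  exact: near_pattern.
have [h [hX h_ge hE]] := layered_level I_layered E XI.
exists (fun n => c (h n) n) => i; apply: pattern_eq.
  apply: filterS2 hX (h_ge i.+1) => n Xn ih.
  exact: (Xn (Ordinal ih)).
move=> k kT; pose x := Tagged (fun i => K i : Type) k.
(* Levels up to [i] are left out, since [c m] is known to have pattern [T i] only for [i < m]. *)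
pose S := [set m | j m = Some x /\ (i < m)%N].
apply: positive_sub (hE S _ _).
- by move=> n [[/= jx _] [y jy]]; move: jx jy => -> [<-].
- move=> N; have [m] := j_rec x (maxn N i.+1).
  by rewrite geq_max => /andP[Nm im] jm; exists m.
- move=> m [jm im]; have := kT; rewrite -(cT m i im) => /patternP.
  by apply: positive_sub => n /= kn; exists x.
Qed.

End saturation.

(** * Bounds on limsups, suprema and infima, and continuous connectives on boxes *)

Lemma limsup_ideal_norm_le (R : realType) (I : ideal) (r : nat -> R) M :
  (forall n, `|r n| <= M) -> `|limsup_ideal I r| <= M.
Proof.
move=> rM; rewrite ler_norml; apply/andP; split.
  apply: (limsup_ideal_ge rM); apply: nearW => n.
  by have := rM n; rewrite ler_norml => /andP[].
apply: (limsup_ideal_le rM); apply: nearW => n.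
exact: le_trans (ler_norm _) (rM n).
Qed.

Lemma sup_norm_le (R : realType) (X : set R) M : X !=set0 ->
  (forall x, X x -> `|x| <= M) -> `|sup X| <= M.
Proof.
move=> [x Xx] XM; rewrite ler_norml; apply/andP; split; last first.
  by apply: ge_sup => [|y /XM]; [exists x|exact/le_trans/ler_norm].
have := XM x Xx; rewrite ler_norml => /andP[/le_trans + _]; apply.
by apply: ub_le_sup => //; exists M => y /XM; exact/le_trans/ler_norm.
Qed.

Lemma inf_norm_le (R : realType) (X : set R) M : X !=set0 ->
  (forall x, X x -> `|x| <= M) -> `|inf X| <= M.
Proof.
move=> [x Xx] XM; rewrite /inf normrN; apply: sup_norm_le.
  by exists (- x), x.
by move=> _ [y /XM yM <-]; rewrite normrN.
Qed.

Lemma sup_le_sup_add (R : realType) (X Y : set R) e : X !=set0 -> has_ubound Y ->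
  (forall x, X x -> exists2 y, Y y & x <= y + e) -> sup X <= sup Y + e.
Proof.
move=> X0 Yub XY; apply: ge_sup => // x /XY[y Yy xy].
by apply: le_trans xy _; rewrite lerD2r ub_le_sup.
Qed.

Lemma inf_le_inf_add (R : realType) (X Y : set R) e : Y !=set0 -> has_lbound X ->
  (forall y, Y y -> exists2 x, X x & x <= y + e) -> inf X <= inf Y + e.
Proof.
move=> Y0 Xlb XY; rewrite -lerBlDr; apply: lb_le_inf => // y /XY[x Xx xy].
by rewrite lerBlDr; apply: le_trans xy; exact: ge_inf.
Qed.

Lemma compact_box (R : realType) k (M : R) :
  compact [set x : 'rV[R]_k | forall i, `[- M, M]%classic (x ord0 i)].
Proof.
apply: (@rV_compact _ _ (fun=> `[- M, M]%classic)) => i.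
exact: segment_compact.
Qed.

Lemma bounded_box (R : realType) k (u : 'rV[R]_k -> R) (M : R) : continuous u ->
  exists N, forall x : 'rV[R]_k, (forall i, `|x 0 i| <= M) -> `|u x| <= N.
Proof.
move=> uC.
have /compact_bounded[N [_ uN]] :=
  continuous_compact (continuous_subspaceT uC) (@compact_box R k M).
exists (N + 1) => x xM; apply: uN; first by rewrite ltrDl.
by exists x => // i; rewrite /= in_itv /= -ler_norml.
Qed.

(** Only [x] is confined to the compact box. Compactness is used in its near-covering form, with [d]
    tending to 0 from the right, so that one [d] serves the whole box. *)
Lemma unif_continuous_box (R : realType) k (u : 'rV[R]_k -> R) (M : R) :
  continuous u ->
  forall e : R, 0 < e -> exists2 d, 0 < d &
  forall x y : 'rV[R]_k, (forall i, `|x 0 i| <= M) ->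
    (forall i, `|x 0 i - y 0 i| <= d) -> `|u x - u y| <= e.
Proof.
move=> uC e e0.
have := @compact_box R k M.
rewrite compact_near_coveringP => /(_ R 0^'+ (fun d x =>
  forall y : 'rV[R]_k, (forall i, `|x ord0 i - y ord0 i| <= d) -> `|u x - u y| <= e) _).
case.
  move=> x _; have /cvgrPdist_lt/(_ _ (divr_gt0 e0 (ltr0n R 2))) := uC x.
  move=> /nbhs_ballP[d /= d0 xd].
  (* Halving the radius keeps both [x'] and any [y] within [t] of it inside [ball x d], where [u] is
     within [e / 2] of [u x]. *)
  exists (ball x (d / 2), [set t | 0 < t < d / 2]) => /=.
    split; first by apply: nbhsx_ballx; rewrite divr_gt0.
    near=> t; apply/andP; split; near: t; first exact: nbhs_right_gt.
    by apply: nbhs_right_lt; rewrite divr_gt0.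
  move=> [x' t] /= [xx' /andP[t0 td]] y x'y.
  have dd : d / 2 <= d by lra.
  have ux' := xd x' (le_ball dd xx').
  have uy : ball x d y.
    rewrite [d]splitr; apply: ball_triangle xx' _.
    split; first by rewrite divr_gt0.
    by move=> i j; rewrite (ord1 i); exact: le_lt_trans (x'y j) td.
  have {}uy := xd _ uy; move: ux' uy => /= ux' uy.
  rewrite [e]splitr; apply: le_trans (ler_distD (u x) _ _) _.
  by rewrite lerD// ltW// distrC.
move=> d /= d0 uM; exists (d / 2); first by rewrite divr_gt0.
move=> x y xM; apply: (uM (d / 2)) => //=.
- by rewrite sub0r normrN gtr0_norm ?divr_gt0//; lra.
- by rewrite divr_gt0.
- by move=> i; rewrite /= in_itv /= -ler_norml.
Unshelve. all: by end_near. Qed.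

(** * Functionals determined by patterns *)

Section determined.
Context {R : realType} (I : ideal).
Implicit Types C : nat -> Type.

Definition determines C (K : finType) (col : forall n, C n -> K) (e : R)
    (Phi : (forall n, C n) -> R) :=
  forall a a', pattern I col a = pattern I col a' -> `|Phi a - Phi a'| <= e.

Definition determined C (Phi : (forall n, C n) -> R) :=
  forall e, 0 < e -> exists (K : finType) (col : forall n, C n -> K),
    determines col e Phi.

Lemma determines_comp C (K K' : finType) (col : forall n, C n -> K)
    (p : K -> K') e Phi :
  determines (fun n c => p (col n c)) e Phi -> determines col e Phi.
Proof.
by move=> det a a' aa'; apply: det; rewrite !pattern_comp aa'.
Qed.

(** The tuple of all the colours works for every [j] at once, each given colouring being a
    projection of it. *)
Lemma determined_family C (J : finType) (Phi : J -> (forall n, C n) -> R) :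
  (forall j, determined (Phi j)) ->
  forall e, 0 < e -> exists (K : finType) (col : forall n, C n -> K),
    forall j, determines col e (Phi j).
Proof.
move=> det e e0.
have K_ j : {K : finType & {col : forall n, C n -> K | determines col e (Phi j)}}.
  by have [K /cid colP] := cid (det j e e0); exists K.
pose K := {dffun forall j, projT1 (K_ j)}.
pose col n c : K := [ffun j => sval (projT2 (K_ j)) n c].
exists K, col => j.
apply: (@determines_comp C K _ col (fun k => k j)).
have -> : (fun n c => col n c j) = sval (projT2 (K_ j)).
  by apply: functional_extensionality_dep => n; apply/funext => c; rewrite ffunE.
exact: (svalP (projT2 (K_ j))).
Qed.

(** The colour of [c] is the index of the interval of length [e], counted from [- M], that contains
    [r n c]. For almost every [n] the colour of [a n] occurs positively along [a'], hence at some
    [m] where [r m (a' m)] is below the limsup along [a'] plus [d]. *)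
Lemma determined_limsup C (r : forall n, C n -> R) M :
  (forall n c, `|r n c| <= M) ->
  determined (fun a : forall n, C n => limsup_ideal I (fun n => r n (a n))).
Proof.
move=> rM e e0; pose N := Num.truncn ((M + M) / e).
pose t n c := Num.truncn ((r n c + M) / e).
have rM0 n c : 0 <= (r n c + M) / e.
  rewrite divr_ge0 ?(ltW e0)//; have := rM n c.
  by rewrite ler_norml => /andP[]; lra.
have tN n c : (t n c < N.+1)%N.
  rewrite ltnS; apply: le_truncn; rewrite ler_wpM2r ?invr_ge0 ?(ltW e0)//.
  by rewrite lerD2r (le_trans (ler_norm _)).
have t_close n c m d : t n c = t m d -> r n c <= r m d + e.
  move=> tt; have /andP[_] := truncn_itv (rM0 n c).
  have /andP[+ _] := truncn_itv (rM0 m d).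
  rewrite -/(t m d) -/(t n c) tt -natr1 ler_pdivlMr// ltr_pdivrMr// mulrDl mul1r.
  lra.
exists 'I_N.+1, (fun n c => inord (t n c)).
set col := fun n c => _.
suff H a a' : pattern I col a = pattern I col a' ->
    limsup_ideal I (fun n => r n (a n)) <= limsup_ideal I (fun n => r n (a' n)) + e.
  by move=> a a' aa'; rewrite ler_distl lerBlDr !H.
move=> aa'; apply/ler_addgt0Pl => d d0.
apply: (limsup_ideal_le (fun n => rM n (a n))).
have lt_a' := @limsup_ideal_lt _ I _ _ (d + limsup_ideal I (fun n => r n (a' n)))
  (fun n => rM n (a' n)).
rewrite ltrDr in lt_a'.
apply: filterS (near_pattern col a) => n; rewrite aa' => /patternP kI.
have [m [/(congr1 (@nat_of_ord _)) mn am]] :=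
  positive_ex (positiveI kI (lt_a' d0)).
rewrite /col !inordK// in mn; have := t_close _ _ _ _ (esym mn).
by move: am => /=; lra.
Qed.

Lemma determined_connective C k (u : 'rV[R]_k -> R)
    (Phi : 'I_k -> (forall n, C n) -> R) (M : R) :
  continuous u -> (forall i a, `|Phi i a| <= M) ->
  (forall i, determined (Phi i)) ->
  determined (fun a => u (\row_i Phi i a)).
Proof.
move=> uC PhiM det e e0; have [d d0 ud] := unif_continuous_box M uC e0.
have [K [col colP]] := determined_family det d0.
exists K, col => a a' aa'; apply: ud => i; rewrite !mxE//.
exact: colP.
Qed.

Section quantifier.
Hypothesis I_layered : layered R I.
Context (C B C' : nat -> Type) (ext : forall n, C n -> B n -> C' n).
Context (b0 : forall n, B n) (Phi : (forall n, C' n) -> R) (M : R).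
Hypotheses (PhiM : forall a, `|Phi a| <= M) (Phi_det : determined Phi).

Let Psi a b := Phi (fun n => ext (a n) (b n)).

Let Psi_lift e : 0 < e -> exists (K : finType) (col : forall n, C n -> K),
  forall a a', pattern I col a = pattern I col a' ->
  forall b, exists b', `|Psi a b - Psi a' b'| <= e.
Proof.
move=> e0; have [K [col colP]] := Phi_det e0.
exists {set K}, (fun n c => [set k | `[< exists y, col n (ext c y) = k >]]%SET).
move=> a a' aa' b; have [b' bb'] := pattern_lift I_layered b aa'.
by exists b'; apply: colP.
Qed.

Lemma determined_sup : determined (fun a => sup (range (Psi a))).
Proof.
move=> e /Psi_lift[K [col colP]]; exists K, col.
suff H a a' : pattern I col a = pattern I col a' ->
    sup (range (Psi a)) <= sup (range (Psi a')) + e.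
  by move=> a a' aa'; rewrite ler_distl lerBlDr !H.
move=> aa'; apply: sup_le_sup_add; first by exists (Psi a b0), b0.
  by exists M => _ [b _ <-]; apply: le_trans (ler_norm _) (PhiM _).
move=> _ [b _ <-]; have [b' bb'] := colP _ _ aa' b.
exists (Psi a' b'); first by exists b'.
by rewrite -lerBlDl (le_trans (ler_norm _)).
Qed.

Lemma determined_inf : determined (fun a => inf (range (Psi a))).
Proof.
move=> e /Psi_lift[K [col colP]]; exists K, col.
suff H a a' : pattern I col a = pattern I col a' ->
    inf (range (Psi a)) <= inf (range (Psi a')) + e.
  by move=> a a' aa'; rewrite ler_distl lerBlDr !H.
move=> aa'; apply: inf_le_inf_add; first by exists (Psi a' b0), b0.
  exists (- M) => _ [b _ <-].
  by have := PhiM (fun n => ext (a n) (b n)); rewrite ler_norml => /andP[].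
move=> _ [b _ <-]; have [b' bb'] := colP _ _ (esym aa') b.
exists (Psi a b'); first by exists b'.
by rewrite -lerBlDl (le_trans (ler_norm _))// distrC.
Qed.

End quantifier.

Lemma ultra_finite (T : Type) (K : finType) (F : set_system T) (g : T -> K) :
  UltraFilter F -> exists k, \forall x \near F, g x = k.
Proof.
move=> FU; apply: contrapT => nF.
have : \forall x \near F, forall k, g x <> k.
  apply: filter_forall => k.
  have [gk|//] := in_ultra_setVsetC [set x | g x = k] FU.
  by case: nF; exists k.
by move=> /filter_ex[x /(_ (g x))].
Qed.

(** Colouring [i] determines the first [i.+1] functionals up to [i.+1%:R^-1]. It has finitely many
    possible patterns, so an ultrafilter finer than [\oo] gives it a limit pattern [T i]; a sequence
    with all these patterns takes the required values. *)
Lemma determined_saturated C (Phi : nat -> (forall n, C n) -> R)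
    (r : nat -> R) : layered R I -> (forall k, determined (Phi k)) ->
  (forall N, exists a, forall k, (k <= N)%N -> `|Phi k a - r k| <= N.+1%:R^-1) ->
  exists a, forall k, Phi k a = r k.
Proof.
move=> I_layered det /choice[c cP].
have colP i : exists Kcol : {K : finType & forall n, C n -> K},
    forall j : 'I_i.+1, determines (projT2 Kcol) i.+1%:R^-1 (Phi j).
  have i0 : 0 < i.+1%:R^-1 :> R by rewrite invr_gt0 ltr0n.
  have [K [col colP]] := determined_family (fun j : 'I_i.+1 => det j) i0.
  by exists (existT _ K col).
have {colP}[Kcol colP] := choice colP.
pose K i := projT1 (Kcol i); pose col i := projT2 (Kcol i) : forall n, C n -> K i.
have [U [FU ooU]] := ultraFilterLemma (eventually_filter : ProperFilter \oo).
have /(_ _)/cid-/all_sig[T UT] i :=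
  ultra_finite (fun N => pattern I (col i) (c N)) FU.
(* Since [U] refines [\oo], arbitrarily late approximate solutions have the first [m] limit
   patterns, and late ones have small error. *)
have mP m : exists N, (m <= N)%N /\
    forall i, (i < m)%N -> pattern I (col i) (c N) = T i.
  have : \forall N \near U, forall i : 'I_m, pattern I (col i) (c N) = T i.
    by apply: filter_forall => i; exact: UT.
  have : \forall N \near U, (m <= N)%N by apply: ooU; exists m.
  move=> U1 U2; have [N [mN NT]] := filter_ex (filterI U1 U2).
  by exists N; split=> // i im; exact: (NT (Ordinal im)).
have [N NP] := choice mP.
have [|a aT] := @pattern_limit _ _ I_layered C K col T (fun m => c (N m)).
  by move=> m i; exact: (NP m).2.
exists a => k; apply/eqP; rewrite -subr_eq0 -normr_le0.
apply/ler_addgt0Pl => e e0; rewrite addr0.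
(* One half of [e] pays for passing from [a] to [c (N i.+1)], of the same pattern for [col i], the
   other half for the error of that approximate solution. *)
pose i := maxn k (Num.truncn (2 / e)).
have ie : i.+1%:R^-1 <= e / 2.
  rewrite -[e / 2]invrK lef_pV2 ?posrE ?invr_gt0 ?divr_gt0// invf_div.
  apply: le_trans (ltW (truncnS_gt _)) _.
  by rewrite ler_nat ltnS leq_maxr.
have ki : (k <= i)%N by rewrite leq_maxl.
have iN : (i < N i.+1)%N by exact: (NP i.+1).1.
rewrite [e]splitr; apply: le_trans (ler_distD (Phi k (c (N i.+1))) _ _) _.
rewrite lerD//; apply: le_trans ie.
  apply: (colP i (Ordinal (ki : (k < i.+1)%N))).
  by rewrite aT (NP i.+1).2.
apply: le_trans (cP _ _ (leq_trans ki (ltnW iN))) _.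
by rewrite lef_pV2 ?posrE// ler_nat ltnW.
Qed.

End determined.

Lemma determined_bounded_limsup (R : realType) (I : ideal) (C : nat -> Type)
    (r : forall n, C n -> R) M (Phi : (forall n, C n) -> R) :
  (forall n c, `|r n c| <= M) ->
  (forall a, Phi a = limsup_ideal I (fun n => r n (a n))) ->
  (exists M, forall a, `|Phi a| <= M) /\ determined I Phi.
Proof.
move=> rM /funext ->; split; last exact: determined_limsup rM.
by exists M => a; exact: limsup_ideal_norm_le.
Qed.

(** * Formulas over the reduced product *)

Section reduced_product.
Context {R : realType} {L : language R} (A : nat -> structure L) (I : ideal).

Local Notation B := (reduced_product A I).

Lemma product_eq s (x y : product A s) : (forall n, pval x n = pval y n) -> x = y.
Proof.
case: x y => [x xD] [y yD] xy; have {}xy : x = y.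
  exact: functional_extensionality_dep.
by subst y; rewrite (Prop_irrelevance xD yD).
Qed.

(** These are the sets to be coloured. The domains are built in, so every sequence of local tuples
    defines a tuple of the quotient in those domains. *)
Definition local_tuple X (V : X -> domain L) n : Type :=
  {w : forall x, A n (tag (V x)) | forall x, dset (A n) (tagged (V x)) (w x)}.

Definition class_tuple X (V : X -> domain L) (a : forall n, local_tuple V n) :
    forall x, B (tag (V x)) :=
  fun x => quo I (pseq (fun n => svalP (a n) x)).

Definition local_par n s (p : B s) : A n s := pval (rep p) n.

Definition local_teval X (V : X -> domain L) n (c : local_tuple V n) s
    (t : term (fun s => B s) V s) : A n s :=
  teval (@local_par n) (sval c) t.

(** One domain has to serve all coordinates: elements of [product] lie in a common domain, and the
    bounds on metric and predicates depend on domains. *)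
Lemma local_teval_dom X (V : X -> domain L) s (t : term (fun s => B s) V s) :
  exists D : dom_sym L s, forall n (c : local_tuple V n),
    dset (A n) D (local_teval c t).
Proof.
elim: t => [x|{}s p|{}s|f t IHt].
- by exists (tagged (V x)) => n c; exact: (svalP c).
- by exists (pdom (rep p)) => n c; exact: pdomP.
- by exists (zdom s) => n c; exact: zint_dom.
- exists (fdom (fun i => sval (cid (IHt i)))) => n c; apply: fint_dom => i.
  exact: (svalP (cid (IHt i))).
Qed.

Definition local_term X (V : X -> domain L) (a : forall n, local_tuple V n) s
    (t : term (fun s => B s) V s) : product A s :=
  pseq (fun n => svalP (cid (local_teval_dom t)) n (a n)).

Lemma teval_class_tuple X (V : X -> domain L) (a : forall n, local_tuple V n) s
    (t : term (fun s => B s) V s) :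
  teval (fun s (b : B s) => b) (class_tuple a) t = quo I (local_term a t).
Proof.
elim: t => [x|{}s p|{}s|f t IHt].
- by congr quo; exact: product_eq.
- by rewrite /= -[LHS]repK; congr quo; exact: product_eq.
- by congr quo; exact: product_eq.
- have -> : local_term a (TApp t) = pfun (fun i => local_term a (t i)).
    exact: product_eq.
  rewrite -qfun_quo /=; congr qfun.
  exact: functional_extensionality_dep.
Qed.

Definition local_extend X (V : X -> domain L) (D : domain L) n
    (c : local_tuple V n) (b : {b : A n (tag D) | dset (A n) (tagged D) b}) :
    local_tuple (extend V D) n :=
  exist (fun w : forall x, A n (tag (extend V D x)) =>
      forall x, dset (A n) (tagged (extend V D x)) (w x))
    (extend_val (sval c) (sval b))
    (fun o => match o with Some x => svalP c x | None => svalP b end).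

Definition some_point (D : domain L) n :
    {b : A n (tag D) | dset (A n) (tagged D) b} :=
  cid (dset_nonempty (A n) (tagged D)).

Lemma class_tuple_extend X (V : X -> domain L) (D : domain L)
    (a : forall n, local_tuple V n)
    (b : forall n, {b : A n (tag D) | dset (A n) (tagged D) b}) :
  class_tuple (fun n => local_extend (a n) (b n)) =
  extend_val (class_tuple a) (quo I (pseq (fun n => svalP (b n))) : B (tag D)).
Proof.
by apply: functional_extensionality_dep => -[x|]; congr quo; exact: product_eq.
Qed.

(** A domain of the quotient is the image of the sequences lying in it coordinatewise, so a
    quantifier over it becomes one over sequences of local points, as in [determined_sup] and
    [determined_inf]. *)
Lemma image_class_extend X (V : X -> domain L) (D : domain L)
    (a : forall n, local_tuple V n) T (g : (forall o, B (tag (extend V D o))) -> T) :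
  [set g (extend_val (class_tuple a) b) | b in dset B (tagged D)] =
  range (fun b : forall n, {b : A n (tag D) | dset (A n) (tagged D) b} =>
    g (class_tuple (fun n => local_extend (a n) (b n)))).
Proof.
apply/seteqP; split => [_ [_ [y yD <-] <-]|_ [b _ <-]].
  exists (fun n => exist (fun b => dset (A n) (tagged D) b) _ (yD n)) => //.
  rewrite class_tuple_extend; congr (g (extend_val _ _)).
  by congr quo; exact: product_eq.
rewrite class_tuple_extend; eexists; last by [].
eexists; last by [].
by move=> n; exact: (svalP (b n)).
Qed.

Hypothesis I_layered : layered R I.

(** Boundedness is carried through the induction because uniform continuity of connectives is
    available on boxes, and real suprema and infima are meaningful for bounded sets. *)
Lemma feval_determined X (V : X -> domain L) (phi : formula (fun s => B s) V) :
  let Phi a := feval (fun s (b : B s) => b) phi (class_tuple a) in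
  (exists M, forall a, `|Phi a| <= M) /\ determined I Phi.
Proof.
elim: phi => {X V} [X V s t u|X V p t|X V k u uC phi IHphi|X V D phi [[M phiM] det]
  |X V D phi [[M phiM] det]] /=.
- have [D tD] := local_teval_dom t; have [E uE] := local_teval_dom u.
  apply: (@determined_bounded_limsup _ _ _
    (fun n c => mdist (local_teval c t) (local_teval c u)) (dbound D E)).
    by move=> n c; rewrite ger0_norm ?mdist_ge0//; exact: dset_bounded.
  by move=> a; rewrite !teval_class_tuple; exact: mdist_quo.
- have [D tD] : exists D : forall i, dom_sym L (@psrc R L p i), forall i n
      (c : local_tuple V n), dset (A n) (D i) (local_teval c (t i)).
    exists (fun i => sval (cid (local_teval_dom (t i)))) => i.
    exact: (svalP (cid (local_teval_dom (t i)))).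
  apply: (@determined_bounded_limsup _ _ _
    (fun n c => pint (A n) p (fun i => local_teval c (t i))) (pbound D)).
    by move=> n c; apply: pint_bound => i; exact: tD.
  move=> a; rewrite -[RHS](@qpred_quo _ _ _ _ _ (fun i => local_term a (t i))).
  congr qpred; apply: functional_extensionality_dep => i.
  exact: teval_class_tuple.
- have [M phiM] := choice (fun i => (IHphi i).1).
  (* A single bound for all the arguments, giving a cube. *)
  pose M' := \sum_i `|M i|.
  have phiM' i a : `|feval (fun s (b : B s) => b) (phi i) (class_tuple a)| <= M'.
    apply: le_trans (phiM i a) _; apply: le_trans (ler_norm _) _.
    by rewrite /M' (bigD1 i)//= lerDl sumr_ge0.
  split; last exact: determined_connective uC phiM' (fun i => (IHphi i).2).
  have [N uN] := bounded_box M' uC; exists N => a; apply: uN => i.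
  by rewrite mxE.
- split; last first.
    rewrite (funext (fun a => congr1 sup (image_class_extend a (feval _ phi)))).
    exact: (determined_sup I_layered (@local_extend _ _ _) (@some_point D) phiM det).
  exists M => a; rewrite image_class_extend; apply: sup_norm_le => [|_ [b _ <-]//].
  by exists (feval (fun s (b : B s) => b) phi
    (class_tuple (fun n => local_extend (a n) (some_point D n)))), (@some_point D).
- split; last first.
    rewrite (funext (fun a => congr1 inf (image_class_extend a (feval _ phi)))).
    exact: (determined_inf I_layered (@local_extend _ _ _) (@some_point D) phiM det).
  exists M => a; rewrite image_class_extend; apply: inf_norm_le => [|_ [b _ <-]//].
  by exists (feval (fun s (b : B s) => b) phi
    (class_tuple (fun n => local_extend (a n) (some_point D n)))), (@some_point D).
Qed.

End reduced_product.

Theorem theorem2p7 (R : realType) (L : language R) (A : nat -> structure L)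
    (I : ideal) (I_layered : layered R I) :
  countably_saturated (reduced_product A I).
Proof.
move=> n V t t_countable t_cons.
have classes a : tuple_in a -> exists c : forall n, local_tuple A V n,
    a = class_tuple I c.
  move=> /qdset_args[x xV ->].
  exists (fun m => exist (fun w : forall i, A m (tag (V i)) =>
    forall i, dset (A m) (tagged (V i)) (w i)) _ (fun i => xV i m)).
  by apply: functional_extensionality_dep => i; congr quo; exact: product_eq.
have class_in (c : forall n, local_tuple A V n) : tuple_in (class_tuple I c).
  by move=> i; eexists; last by []; move=> m; exact: (svalP (c m)).
have /pfcard_geP[t0|[g]] := t_countable.
  (* An empty type has no enumeration; consistency of its empty subset still supplies a tuple in the
     domains. *)
  have [a a_in _] := t_cons set0 (finite_set0 _) (sub0set _) 1 ltr01.
  by exists a => // c; rewrite t0.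
have gt k : t (g k) by exact: (@funS _ _ _ _ g k).
have [|N|c gc] := @determined_saturated R I (local_tuple A V)
  (fun k c => value (g k).1 (class_tuple I c)) (fun k => (g k).2) I_layered.
- by move=> k; exact: (feval_determined I_layered _).2.
(* Consistency is applied to the first [N.+1] conditions with error [N.+1%:R^-1]. *)
- have Ffin : finite_set [set g k | k in `I_N.+1].
    by apply: finite_image; exact: finite_II.
  have Ft : [set g k | k in `I_N.+1] `<=` t by move=> _ [k _ <-].
  have N0 : 0 < N.+1%:R^-1 :> R by rewrite invr_gt0 ltr0n.
  have [a /classes[c ->] ac] := t_cons _ Ffin Ft _ N0.
  by exists c => k kN; apply: ac; exists k.
- exists (class_tuple I c) => // x tx.
  have [k _ <-] := (@surj _ _ _ _ g x tx).
  exact: gc.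
Qed.
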